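(* Let $(H,\circ)$ be a hypersemigroup. If $A$ is an interior ideal of $H$, then the characteristic function $f_A$ is a fuzzy interior ideal of $H$. Conversely, if $A$ is a nonempty subset of $H$ such that $f_A$ is a fuzzy interior ideal of $H$, then $A$ is an interior ideal of $H$.
   Context: A hypergroupoid is a nonempty set $H$ with a map $\circ: H\times H\to \mathcal{P}^*(H)$, where $\mathcal{P}^*(H)$ is the set of nonempty subsets of $H$. For $A,B\in\mathcal{P}^*(H)$ put $A*B=\bigcup_{(a,b)\in A\times B}(a\circ b)$; thus $\{x\}*\{y\}=x\circ y$. A hypersemigroup is a hypergroupoid with $\{x\}*(y\circ z)=(x\circ y)*\{z\}$ for all $x,y,z\in H$; then $*$ is associative on $\mathcal{P}^*(H)$, so $A*B*C$ is unambiguous. A nonempty subset $A$ of $H$ is an interior ideal of $H$ if $H*A*H\subseteq A$. A fuzzy subset of $H$ is a map $f:H\to[0,1]$ (real interval). For $A\subseteq H$, the characteristic function $f_A:H\to[0,1]$ is given by $f_A(x)=1$ if $x\in A$ and $f_A(x)=0$ if $x\notin A$. A fuzzy subset $f$ of $H$ is a fuzzy interior ideal of $H$ if $f((x\circ a)*\{y\})\ge f(a)$ for all $x,a,y\in H$, meaning: for all $x,a,y\in H$ and all $u\in (x\circ a)*\{y\}$, $f(u)\ge f(a)$. *)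

(* Defs.v *)
From mathcomp Require Import all_boot all_order all_algebra.
From mathcomp Require Import all_classical all_reals all_analysis.

Set Implicit Arguments.
Unset Strict Implicit.
Unset Printing Implicit Defensive.

Import Order.TTheory GRing.Theory Num.Theory.

Local Open Scope classical_set_scope.
Local Open Scope ring_scope.

Record hypergroupoid := Hypergroupoid {
  hcarrier :> Type;
  hcarrier_inhabited : inhabited hcarrier;
  hop : hcarrier -> hcarrier -> set hcarrier;
  hop_nonempty : forall x y, hop x y !=set0 }.

(* The formula makes sense for all subsets; [setop_nonempty] shows that it
   restricts to an operation on nonempty subsets. *)
Definition setop (H : hypergroupoid) (A B : set H) : set H :=
  \bigcup_(p in A `*` B) hop p.1 p.2.

Record hypersemigroup := Hypersemigroup {
  hsg_hypergroupoid :> hypergroupoid;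
  hopA : forall x y z : hsg_hypergroupoid,
    setop [set x] (hop y z) = setop (hop x y) [set z] }.

Lemma setop_nonempty (H : hypergroupoid) (A B : set H) :
  A !=set0 -> B !=set0 -> setop A B !=set0.
Proof.
move=> [a Aa] [b Bb]; have [u abu] := hop_nonempty a b.
by exists u, (a, b).
Qed.

Lemma setop1 (H : hypergroupoid) (x y : H) : setop [set x] [set y] = hop x y.
Proof.
apply/seteqP; split=> [u [[_ _] [/= -> ->]] //|u xyu].
by exists (x, y).
Qed.

Lemma setopA (H : hypersemigroup) (A B C : set H) :
  setop A (setop B C) = setop (setop A B) C.
Proof.
apply/seteqP; split=> u.
  move=> [[a v] [/= Aa [[b c] [/= Bb Cc] bcv]] avu].
  have : setop [set a] (hop b c) u by exists (a, v).
  rewrite hopA => -[[w d] [/= abw ->] wcu].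
  by exists (w, c) => //; split=> //; exists (a, b).
move=> [[v c] [/= [[a b] [/= Aa Bb] abv] Cc] vcu].
have : setop (hop a b) [set c] u by exists (v, c).
rewrite -hopA => -[[d w] [/= -> bcw] awu].
by exists (a, w) => //; split=> //; exists (b, c).
Qed.

(* [H * A * H] is bracketed to the left; by [setopA] the choice is immaterial. *)
Definition interior_ideal (H : hypersemigroup) (A : set H) : Prop :=
  A !=set0 /\ setop (setop setT A) setT `<=` A.

Definition fuzzy_subset (R : realType) (H : Type) : Type := H -> {i01 R}.

Definition char_fun (R : realType) (H : Type) (A : set H) : fuzzy_subset R H :=
  fun x => if x \in A then 1%:i01 else 0%:i01.

Definition fuzzy_interior_ideal (R : realType) (H : hypersemigroup)
    (f : fuzzy_subset R H) : Prop :=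
  forall x a y u : H, setop (hop x a) [set y] u -> f a <= f u.

(* Main.v *)
Require Import Defs.
From mathcomp Require Import all_boot all_order all_algebra.
From mathcomp Require Import all_classical all_reals all_analysis.

(** Since a characteristic function takes only the values [0] and [1], the
    inequality [f_A a <= f_A u] carries exactly the information [A a -> A u]
    ([char_fun_le]).  On the other hand [H * A * H] is the union of the sets
    [(x o a) * {y}] with [a] in [A] and [x], [y] arbitrary ([mem_setopTAT]).
    Hence both [H * A * H `<=` A] and the fuzzy condition on [f_A] say that
    [u] is in [A] whenever [u] is in some [(x o a) * {y}] with [a] in [A];
    they differ only in the order of the quantifiers and hypotheses. *)

Local Open Scope classical_set_scope.

Lemma char_fun_le (R : realType) (T : Type) (A : set T) (a u : T) :
  (char_fun R A a <= char_fun R A u)%R <-> (A a -> A u).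
Proof.
rewrite /char_fun -num_le.
case: (asboolP (A a)) => Aa; case: (asboolP (A u)) => Au;
  rewrite ?(mem_set Aa) ?(mem_set Au) ?(memNset Aa) ?(memNset Au) /=.
- by rewrite Order.POrderTheory.lexx.
- by rewrite Num.Theory.ler10; split=> // /(_ Aa).
- by rewrite Num.Theory.ler01.
- by rewrite Order.POrderTheory.lexx.
Qed.

Lemma mem_setopTAT (H : hypergroupoid) (A : set H) (u : H) :
  setop (setop setT A) setT u <->
  exists x a y, A a /\ setop (hop x a) [set y] u.
Proof.
split=> [[[v y] [/= [[x a] [/= _ Aa] xav] _] vyu]|].
  by exists x, a, y; split=> //; exists (v, y).
move=> [x [a [_ [Aa [[v y] [/= xav _] vyu]]]]].
by exists (v, y) => //; split=> //; exists (x, a).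
Qed.

Theorem proposition2p3 (R : realType) (H : hypersemigroup) (A : set H) :
  (interior_ideal A -> fuzzy_interior_ideal (char_fun R A)) /\
  (A !=set0 -> fuzzy_interior_ideal (char_fun R A) -> interior_ideal A).
Proof.
split=> [[_ HAHA] x a y u xayu|A0 fA].
  apply/char_fun_le => Aa; apply: HAHA.
  by apply/mem_setopTAT; exists x, a, y.
split=> // u /mem_setopTAT [x [a [y [Aa xayu]]]].
by move/char_fun_le: (fA x a y u xayu); apply.
Qed.
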